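(* Let $\frac{p_1}{q_1},\frac{p_2}{q_2},\frac{p_{12}}{q_{12}}$ be nonzero rationals for which the resonance relation $\frac{p_1}{q_1}T_{rev_1}=\frac{p_2}{q_2}T_{rev_2}=\frac{p_{12}}{q_{12}}T_{rev_{12}}$ between the revival periods holds, and suppose $\frac{p_{12}}{q_{12}}\in\mathbb{Z}$. For $j=1,2$ let $s_j:=q_{12}p_j$ and $\ell_j:=q_js_j$, the integers being chosen so that $\ell_1,\ell_2\geq1$. Then for all $k_1\in\{0,\dots,\ell_1-1\}$ and $k_2\in\{0,\dots,\ell_2-1\}$, $$|b_{k_1,k_2}|^2=\big|d_{k_1}(\ell_1,p_1s_1,\ell_1)\big|^2\,\big|d_{k_2}(\ell_2,p_2s_2,\ell_2)\big|^2.$$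
   Context: $T_{rev_1},T_{rev_2},T_{rev_{12}}$ are the revival periods: for $\omega_1,\omega_2>0$, $h>0$, a polynomial $F\in\mathbb{R}[X,Y]$ and a point $(E_1,E_2)$ at which $\frac{\partial^2F}{\partial X^2},\frac{\partial^2F}{\partial X\partial Y},\frac{\partial^2F}{\partial Y^2}$ are nonzero, $$T_{rev_1}:=\frac{4\pi}{h\,\omega_1^2\frac{\partial^2F}{\partial X^2}(E_1,E_2)},\quad T_{rev_2}:=\frac{4\pi}{h\,\omega_2^2\frac{\partial^2F}{\partial Y^2}(E_1,E_2)},\quad T_{rev_{12}}:=\frac{4\pi}{h\,\omega_1\omega_2\frac{\partial^2F}{\partial X\partial Y}(E_1,E_2)}.$$ $n_0,m_0\in\mathbb{N}$ are integers (depending on $h$): with $\tau_n:=\omega_1h(n+\frac12)$ and $\mu_m:=\omega_2h(m+\frac12)$, $n_0$ minimizes $|\tau_n-E_1|$ and $m_0$ minimizes $|\mu_m-E_2|$. The revival coefficients are $$b_{k_1,k_2}:=\frac{1}{\ell_1\ell_2}\sum_{n=0}^{\ell_1-1}\sum_{m=0}^{\ell_2-1}\theta_{n,m}\,e^{\frac{2i\pi k_1n}{\ell_1}}e^{\frac{2i\pi k_2m}{\ell_2}},\qquad \theta_{n,m}:=e^{-2i\pi\left(\frac{p_1}{q_1}(n-n_0)^2+\frac{p_{12}}{q_{12}}(n-n_0)(m-m_0)+\frac{p_2}{q_2}(m-m_0)^2\right)}.$$ For an integer $\ell\geq1$, integers $p,q$ with $q\neq0$, and $k\in\{0,\dots,\ell-1\}$,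 $$d_k(\ell,p,q):=\frac1\ell\sum_{n=0}^{\ell-1}e^{-2i\pi\frac pq(n-n_0)^2}e^{\frac{2i\pi kn}{\ell}}.$$ *)

(* Defs.v *)
From HB Require Import structures.
From mathcomp Require Import all_boot all_order all_algebra.
From mathcomp Require Import reals trigo.
From mathcomp Require Import complex.
From mathcomp Require mpoly.

Set Implicit Arguments.
Unset Strict Implicit.
Unset Printing Implicit Defensive.

Import Order.TTheory GRing.Theory Num.Theory.
Local Open Scope ring_scope.
Local Open Scope complex_scope.

(* Real bivariate polynomials: the variable of index 0 is X and the variable of
   index 1 is Y. *)
Notation bipoly R := (mpoly.mpoly 2 R).
Notation iX := (@ord0 1) (only parsing).
Notation iY := (@ord_max 1) (only parsing).

Section Revival.
Variable R : realType.
Implicit Types (omega h E : R) (F : bipoly R) (n m k l : nat) (p q : int).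

Definition partial2 (i j : 'I_2) F (E1 E2 : R) : R :=
  mpoly.meval (fun v : 'I_2 => if v == iX then E1 else E2)
    (mpoly.mderiv i (mpoly.mderiv j F)).

Definition Trev1 omega1 h F (E1 E2 : R) : R :=
  4 * pi / (h * omega1 ^+ 2 * partial2 iX iX F E1 E2).

Definition Trev2 omega2 h F (E1 E2 : R) : R :=
  4 * pi / (h * omega2 ^+ 2 * partial2 iY iY F E1 E2).

Definition Trev12 omega1 omega2 h F (E1 E2 : R) : R :=
  4 * pi / (h * omega1 * omega2 * partial2 iX iY F E1 E2).

(* tau_n for omega = omega_1, and mu_n for omega = omega_2 *)
Definition level omega h n : R := omega * h * (n%:R + 2^-1).

Definition nearest_level omega h E n0 : Prop :=
  forall n, `|level omega h n0 - E| <= `|level omega h n - E|.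

(* e^{i t} for real t *)
Definition expi (t : R) : R[i] := cos t +i* sin t.

Definition qfrac p q : R := p%:~R / q%:~R.

(* n - n0 as a real number: the subtraction must not be truncated *)
Definition shift n0 n : R := n%:R - n0%:R.

Definition theta n0 m0 p1 q1 p2 q2 p12 q12 n m : R[i] :=
  expi (- (2 * pi * (qfrac p1 q1 * shift n0 n ^+ 2
                     + qfrac p12 q12 * (shift n0 n * shift m0 m)
                     + qfrac p2 q2 * shift m0 m ^+ 2))).

Definition revival_coef n0 m0 p1 q1 p2 q2 p12 q12 l1 l2 k1 k2 : R[i] :=
  (l1%:R * l2%:R)^-1 *
  \sum_(0 <= n < l1) \sum_(0 <= m < l2)
     theta n0 m0 p1 q1 p2 q2 p12 q12 n m
     * expi (2 * pi * (k1%:R * n%:R / l1%:R))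
     * expi (2 * pi * (k2%:R * m%:R / l2%:R)).

Definition dcoef n0 k l p q : R[i] :=
  l%:R^-1 *
  \sum_(0 <= n < l)
     expi (- (2 * pi * (qfrac p q * shift n0 n ^+ 2)))
     * expi (2 * pi * (k%:R * n%:R / l%:R)).

End Revival.

(* Main.v *)
(** Since p12/q12 is an integer, the cross term only multiplies the summands by
   exp(2 i pi z) with z an integer, so the double sum is a product of two
   quadratic Gauss sums with n0 and m0 as centres. The statement centres both
   factors d_k at n0, which is harmless: l * p/q is an integer, so the
   summands are l-periodic, and moving the centre by 1 reindexes the sum and
   multiplies it by exp(2 i pi k/l). *)

Require Import Defs.
From HB Require Import structures.
From mathcomp Require Import all_boot all_order all_algebra.
From mathcomp Require Import reals trigo.
From mathcomp Require Import complex.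
From mathcomp Require mpoly.
From mathcomp Require Import ring.

Set Implicit Arguments.
Unset Strict Implicit.
Unset Printing Implicit Defensive.

Import Order.TTheory GRing.Theory Num.Theory.
Local Open Scope ring_scope.
Local Open Scope complex_scope.

Section GaussSum.
Variable R : realType.
Implicit Types (x y a : R) (n m k l : nat) (p q z : int).

Lemma expiD x y : expi (x + y) = expi x * expi y.
Proof.
by apply/eqP; rewrite eq_complex /= cosD sinD [cos x * sin y + _]addrC !eqxx.
Qed.

Lemma expi0 : expi (0 : R) = 1.
Proof. by rewrite /expi cos0 sin0. Qed.

Lemma normr_expi x : `|expi x| = 1.
Proof. by rewrite normc_def /= cos2Dsin2 sqrtr1. Qed.

Lemma expi_2pi_nat n : expi (2 * pi * n%:R : R) = 1.
Proof.
elim: n => [|n IHn]; first by rewrite mulr0 expi0.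
rewrite -[n.+1%:R]natr1 mulrDr expiD IHn mul1r mulr1 mulr_natl.
by rewrite /expi cos2pi sin2pi.
Qed.

Lemma expi_2pi_int x : x \is a Num.int -> expi (2 * pi * x) = 1.
Proof.
move=> /intrP[z ->]; case: z => n; first by rewrite -pmulrn expi_2pi_nat.
rewrite NegzE rmorphN /= -pmulrn mulrN.
(* Multiplying by 1 = [expi (2 * pi * n.+1%:R)] cancels the negative exponent. *)
rewrite -[LHS]mul1r -[X in X * _](expi_2pi_nat n.+1) -expiD.
by rewrite subrr expi0.
Qed.

(** A real [a] stands for p/q: the argument only uses that [l%:R * a] is an integer. *)
Definition gauss_term a k l n0 n : R[i] :=
  expi (- (2 * pi * (a * shift R n0 n ^+ 2)))
  * expi (2 * pi * (k%:R * n%:R / l%:R)).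

(** Shifting index and centre together fixes n - n0, so only the linear phase changes, by a factor
    independent of n. *)
Lemma gauss_termSS a k l n0 n :
  gauss_term a k l n0.+1 n.+1
  = expi (2 * pi * (k%:R / l%:R)) * gauss_term a k l n0 n.
Proof.
rewrite /gauss_term /shift -!expiD; congr expi.
by rewrite -[n.+1%:R]natr1 -[n0.+1%:R]natr1; ring.
Qed.

(** Since (l - n0)^2 - n0^2 = l (l - 2 n0), the two quadratic phases differ by 2 pi times the
    integer (l a)(2 n0 - l). *)
Lemma gauss_term_period a k l n0 : (0 < l)%N -> l%:R * a \is a Num.int ->
  gauss_term a k l n0 l = gauss_term a k l n0 0.
Proof.
move=> l0 la; rewrite /gauss_term /shift.
have lR : l%:R != 0 :> R by rewrite pnatr_eq0 -lt0n.
rewrite mulfK // expi_2pi_nat mulr0 mul0r mulr0 expi0 !mulr1.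
have -> : - (2 * pi * (a * (l%:R - n0%:R) ^+ 2))
    = - (2 * pi * (a * (0 - n0%:R) ^+ 2))
      + 2 * pi * ((l%:R * a) * (n0%:R *+ 2 - l%:R)) :> R by ring.
rewrite expiD [X in _ * X]expi_2pi_int ?mulr1 //.
by rewrite rpredM // rpredB ?rpred_nat // rpredMn ?rpred_nat.
Qed.

Lemma normr_gauss_sumS a k l n0 : (0 < l)%N -> l%:R * a \is a Num.int ->
  `|\sum_(0 <= n < l) gauss_term a k l n0.+1 n|
  = `|\sum_(0 <= n < l) gauss_term a k l n0 n|.
Proof.
move=> l0 la.
(* The ranges 0..l-1 and 1..l differ only in their end terms, which agree by periodicity. *)
have -> : \sum_(0 <= n < l) gauss_term a k l n0.+1 n
    = \sum_(0 <= n < l) gauss_term a k l n0.+1 n.+1.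
  case: l l0 la => // l l0 la.
  by rewrite big_nat_recl // big_nat_recr //= gauss_term_period // addrC.
under eq_bigr do rewrite gauss_termSS.
by rewrite -mulr_sumr normrM normr_expi mul1r.
Qed.

Lemma normr_gauss_sum a k l n0 m0 : (0 < l)%N -> l%:R * a \is a Num.int ->
  `|\sum_(0 <= n < l) gauss_term a k l n0 n|
  = `|\sum_(0 <= n < l) gauss_term a k l m0 n|.
Proof.
move=> l0 la.
suff center0 c : `|\sum_(0 <= n < l) gauss_term a k l c n|
    = `|\sum_(0 <= n < l) gauss_term a k l 0 n| by rewrite !center0.
by elim: c => // c IHc; rewrite normr_gauss_sumS.
Qed.

Lemma theta_int_cross n0 m0 p1 q1 p2 q2 p12 q12 n m :
  qfrac R p12 q12 \is a Num.int ->
  theta R n0 m0 p1 q1 p2 q2 p12 q12 n m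
  = expi (- (2 * pi * (qfrac R p1 q1 * shift R n0 n ^+ 2)))
    * expi (- (2 * pi * (qfrac R p2 q2 * shift R m0 m ^+ 2))).
Proof.
move=> hint; rewrite /theta.
set c := qfrac R p12 q12 * _.
have shiftZ i j : shift R i j \is a Num.int by rewrite rpredB // rpred_nat.
have cZ : - c \is a Num.int by rewrite rpredN /c rpredM // rpredM.
(* The right side is multiplied by 1 = [expi (2 * pi * - c)], which supplies the cross term. *)
rewrite -expiD -[RHS]mulr1 -[X in _ = _ * X](expi_2pi_int cZ) -expiD; congr expi.
by ring.
Qed.

Lemma revival_coef_int_cross n0 m0 p1 q1 p2 q2 p12 q12 l1 l2 k1 k2 :
  qfrac R p12 q12 \is a Num.int ->
  revival_coef R n0 m0 p1 q1 p2 q2 p12 q12 l1 l2 k1 k2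
  = dcoef R n0 k1 l1 p1 q1 * dcoef R m0 k2 l2 p2 q2.
Proof.
move=> hint; rewrite /revival_coef /dcoef invfM mulrACA; congr (_ * _).
rewrite mulr_suml; apply: eq_bigr => n _; rewrite mulr_sumr.
apply: eq_bigr => m _; rewrite theta_int_cross //.
(* Each quadratic phase is paired with the linear phase in the same index. *)
by rewrite -[LHS]mulrA mulrACA.
Qed.

Lemma normr_dcoef_center n0 m0 k l p q : (0 < l)%N ->
  l%:R * qfrac R p q \is a Num.int ->
  `|dcoef R n0 k l p q| = `|dcoef R m0 k l p q|.
Proof.
move=> l0 lpq; rewrite /dcoef !normrM; congr (_ * _).
exact: normr_gauss_sum.
Qed.

Lemma qfracMr p q z : z != 0 -> qfrac R (p * z) (q * z) = qfrac R p q.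
Proof.
move=> z0; rewrite /qfrac !intrM -mulf_div divff ?mulr1 //.
by rewrite intr_eq0.
Qed.

Lemma dcoefMr n0 k l p q z : z != 0 ->
  dcoef R n0 k l (p * z) (q * z) = dcoef R n0 k l p q.
Proof. by move=> z0; rewrite /dcoef qfracMr. Qed.

End GaussSum.

Theorem theorem4p19 (R : realType) (omega1 omega2 h : R) (F : bipoly R)
    (E1 E2 : R) (n0 m0 : nat) (p1 q1 p2 q2 p12 q12 : int)
    (s1 s2 : int) (l1 l2 : nat)
    (homega1 : 0 < omega1) (homega2 : 0 < omega2) (hh : 0 < h)
    (hFXX : partial2 iX iX F E1 E2 != 0)
    (hFXY : partial2 iX iY F E1 E2 != 0)
    (hFYY : partial2 iY iY F E1 E2 != 0)
    (hn0 : nearest_level omega1 h E1 n0)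
    (hm0 : nearest_level omega2 h E2 m0)
    (hp1 : p1 != 0) (hq1 : q1 != 0)
    (hp2 : p2 != 0) (hq2 : q2 != 0)
    (hp12 : p12 != 0) (hq12 : q12 != 0)
    (hres1 : qfrac R p1 q1 * Trev1 omega1 h F E1 E2
             = qfrac R p2 q2 * Trev2 omega2 h F E1 E2)
    (hres2 : qfrac R p2 q2 * Trev2 omega2 h F E1 E2
             = qfrac R p12 q12 * Trev12 omega1 omega2 h F E1 E2)
    (hint : qfrac R p12 q12 \is a Num.int)
    (hs1 : s1 = q12 * p1) (hs2 : s2 = q12 * p2)
    (hl1 : l1%:Z = q1 * s1) (hl2 : l2%:Z = q2 * s2)
    (hl1_ge1 : (1 <= l1)%N) (hl2_ge1 : (1 <= l2)%N) :
  forall k1 k2 : nat, (k1 < l1)%N -> (k2 < l2)%N ->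
    `|revival_coef R n0 m0 p1 q1 p2 q2 p12 q12 l1 l2 k1 k2| ^+ 2
    = `|dcoef R n0 k1 l1 (p1 * s1) l1%:Z| ^+ 2
      * `|dcoef R n0 k2 l2 (p2 * s2) l2%:Z| ^+ 2.
Proof.
move=> k1 k2 _ _.
have s1_neq0 : s1 != 0 by rewrite hs1 mulf_neq0.
have s2_neq0 : s2 != 0 by rewrite hs2 mulf_neq0.
(* From l2 = q2 s2 one gets l2 p2/q2 = s2 p2; this integrality permits moving the centre of the
   second factor. *)
have l2Z : l2%:R * qfrac R p2 q2 \is a Num.int.
  have -> : l2%:R * qfrac R p2 q2 = (s2 * p2)%:~R.
    rewrite -[l2%:R]/(l2%:Z%:~R) hl2 /qfrac !intrM.
    by field; rewrite intr_eq0.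
  exact: intr_int.
(* Writing l_j as q_j s_j lets s_j cancel in p_j s_j / l_j; it then remains to replace the centre m0
   by n0 in the second factor. *)
rewrite revival_coef_int_cross // hl1 hl2 !dcoefMr // normrM exprMn.
by rewrite (normr_dcoef_center m0 n0).
Qed.
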